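(* Let $S$ be an embeddable monoid and let $\alpha$ be a surjective continuous action $S\curvearrowright X$ on a topological space $X$. If $\boldsymbol{\Gamma}=(\Gamma,\gamma)$ is the free $S$-group and $\mathbf{X}_{\boldsymbol{\Gamma}}=(X_{\boldsymbol{\Gamma}},\sigma,\pi)$ is the natural $\boldsymbol{\Gamma}$-extension of $\alpha$, then the pair $(\boldsymbol{\Gamma},\mathbf{X}_{\boldsymbol{\Gamma}})$ is a terminal object in the category $\mathsf{Ext}_\alpha$.
   Context: All semigroups (in particular all monoids and groups) are countable and discrete. A continuous action $\alpha$ of a monoid $S$ on a topological space $X$ is a map $(s,x)\mapsto s\cdot x=\alpha_s(x)$ with $1_S\cdot x=x$, $s\cdot(t\cdot x)=(st)\cdot x$, and each $\alpha_s$ continuous; it is surjective if each $\alpha_s$ is surjective. $S$ is embeddable if there is an injective semigroup morphism from $S$ into a group. A receiving $S$-group is a pair $\mathbf{G}=(G,\eta)$ with $G$ a group and $\eta\colon S\to G$ an injective semigroup morphism such that $\eta(S)$ generates $G$ as a group. An $S$-group is a pair $(G,\eta)$ with $G$ a group and $\eta\colon S\to G$ a semigroup morphism (not necessarily injective) such that $\eta(S)$ generates $G$ as a group. A morphism of $S$-groups $(G,\eta)\to(G',\eta')$ is a group morphism $\theta\colon G\to G'$ with $\theta\circ\eta=\eta'$. The free $S$-group $(\Gamma,\gamma)$ is the initial object in the category of $S$-groups (unique up to isomorphism; when $S$ is embeddable, $\gamma$ is injective). A $\mathbf{G}$-extension of $\alpha$ is a tuple $(\hat X,\beta,\tau)$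 where $\beta$ is a continuous action $G\curvearrowright\hat X$ on a topological space and $\tau\colon\hat X\to X$ is a continuous surjection with $s\cdot\tau(\hat x)=\tau(\eta(s)\cdot\hat x)$ for all $s\in S$, $\hat x\in\hat X$. The $\mathbf{G}$-extension is natural if for any other $\mathbf{G}$-extension $(\hat X',\beta',\tau')$ of $\alpha$ there is a unique continuous $G$-equivariant map $\varphi\colon\hat X'\to\hat X$ with $\tau\circ\varphi=\tau'$. The natural $\boldsymbol{\Gamma}$-extension of $\alpha$ is given concretely by $X_{\boldsymbol{\Gamma}}=\{(x_h)_{h\in\Gamma}\in X^\Gamma: s\cdot x_h=x_{\gamma(s)h}\ \forall s\in S,h\in\Gamma\}$ with the subspace topology of the product topology, $\sigma$ the shift action $(g\cdot\overline x)_h=x_{hg}$, and $\pi((x_h)_h)=x_{1_\Gamma}$. The category $\mathsf{Ext}_\alpha$: objects are pairs $(\mathbf{G},\hat{\mathbf{X}})$ where $\mathbf{G}=(G,\eta)$ is a receiving $S$-group and $\hat{\mathbf{X}}=(Y,\beta,\tau)$ is a $\mathbf{G}$-extension of $\alpha$. An arrow $(\mathbf{G}',\hat{\mathbf{X}}')\to(\mathbf{G},\hat{\mathbf{X}})$, with $\hat{\mathbf{X}}=(Y,\beta,\tau)$ and $\hat{\mathbf{X}}'=(Y',\beta',\tau')$, is a pair $(\theta,\varphi)$ where $\theta$ is a morphism of $S$-groups from $\mathbf{G}$ to $\mathbf{G}'$ and $\varphi\colon Y'\to Y$ is a continuous map with $\tau\circ\varphi=\tau'$ and $\varphi\circ\beta'_{\theta(g)}=\beta_g\circ\varphi$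 for all $g\in G$. Composition is $(\theta_1,\varphi_1)\circ(\theta_2,\varphi_2)=(\theta_2\circ\theta_1,\varphi_1\circ\varphi_2)$.
   Formalization: The formal theorem additionally assumes that π: X_Γ → X is surjective, i.e. that X_Γ really is a Γ-extension; this can fail for a surjective action of an embeddable monoid, and then the pair is not an object of Ext_α. *)

(* Defs.v *)
From HB Require Import structures.
From mathcomp Require Import all_boot.
From mathcomp Require Import all_classical topology.

Set Implicit Arguments.
Unset Strict Implicit.
Unset Printing Implicit Defensive.

Local Open Scope classical_set_scope.
Local Open Scope group_scope.

Record category := Category {
  obj :> Type;
  hom : obj -> obj -> Type;
  idc : forall A, hom A A;
  comp : forall A B C, hom B C -> hom A B -> hom A C;
  compIl : forall A B (f : hom A B), comp (idc B) f = f;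
  compIr : forall A B (f : hom A B), comp f (idc A) = f;
  compA : forall A B C D (f : hom C D) (g : hom B C) (h : hom A B),
    comp f (comp g h) = comp (comp f g) h }.

Definition initial (C : category) (I : C) : Prop :=
  forall A : C, exists f : hom I A, forall g : hom I A, g = f.

Definition terminal (C : category) (T : C) : Prop :=
  forall A : C, exists f : hom A T, forall g : hom A T, g = f.

Definition continuous_action (M : monoidType) (X : topologicalType)
    (a : M -> X -> X) : Prop :=
  [/\ forall x, a 1 x = x,
      forall s t x, a s (a t x) = a (s * t) x &
      forall s, continuous (a s)].

Definition surjective_action (M : monoidType) (X : topologicalType)
    (a : M -> X -> X) : Prop :=
  forall s, set_surj [set: X] [set: X] (a s).

(* The target group is not required to be countable: when S is countable, so is
   the subgroup generated by the image of S. *)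
Definition embeddable (S : monoidType) : Prop :=
  exists (G : groupType) (i : {multiplicative S -> G}), injective i.

Definition generates (S : monoidType) (G : groupType) (eta : S -> G) : Prop :=
  forall H : {pred G}, group_closed H -> (forall s, eta s \in H) ->
  forall g, g \in H.

(* The group of an S-group is automatically countable when S is. *)
Record sgroup (S : monoidType) := SGroup {
  sg_group :> groupType;
  sg_map : {multiplicative S -> sg_group};
  sg_generates : generates sg_map }.

Definition receiving (S : monoidType) (G : sgroup S) : Prop :=
  injective (sg_map G).

(* On groups, multiplicative maps are exactly the group morphisms. *)
Record sgroup_hom (S : monoidType) (G G' : sgroup S) := SGroupHom {
  sgh_map :> {multiplicative G -> G'};
  sgh_comm : forall s, sgh_map (sg_map G s) = sg_map G' s }.

Section SGroupCategory.
Variable S : monoidType.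

Lemma sgroup_hom_eq (G G' : sgroup S) (f g : sgroup_hom G G') :
  f =1 g -> f = g.
Proof.
case: f g => [f fE] [g gE] /= fg.
have efg : f = g :> {multiplicative G -> G'}.
  case: f g fg {fE gE} => [f [[fm]]] [g [[gm]]] /= /funext fg.
  by case: _ / fg gm => gm; rewrite (Prop_irrelevance fm gm).
by case: _ / efg gE => gE; congr SGroupHom; exact: Prop_irrelevance.
Qed.

Definition sgroup_id (G : sgroup S) : sgroup_hom G G :=
  @SGroupHom S G G idfun (fun=> erefl).

Lemma sgroup_comp_comm (A B C : sgroup S) (f : sgroup_hom B C)
  (g : sgroup_hom A B) s : (f \o g) (sg_map A s) = sg_map C s.
Proof. by rewrite /= !sgh_comm. Qed.

Definition sgroup_comp (A B C : sgroup S) (f : sgroup_hom B C)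
    (g : sgroup_hom A B) : sgroup_hom A C :=
  @SGroupHom S A C (f \o g) (sgroup_comp_comm f g).

Definition SGrp : category.
Proof.
by refine (@Category (sgroup S) (@sgroup_hom S) sgroup_id sgroup_comp _ _ _);
  move=> *; apply: sgroup_hom_eq.
Defined.

End SGroupCategory.

Definition free_sgroup (S : monoidType) (G : sgroup S) : Prop :=
  @initial (SGrp S) G.

Definition is_extension (S : monoidType) (X : topologicalType)
    (alpha : S -> X -> X) (G : sgroup S) (Y : topologicalType)
    (beta : G -> Y -> Y) (tau : Y -> X) : Prop :=
  [/\ continuous_action beta, continuous tau, set_surj [set: Y] [set: X] tau &
      forall s y, alpha s (tau y) = tau (beta (sg_map G s) y)].

Section Ext.
Variables (S : monoidType) (X : topologicalType) (alpha : S -> X -> X).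

Record ext_obj := ExtObj {
  eo_sgroup : sgroup S;
  eo_receiving : receiving eo_sgroup;
  eo_space : topologicalType;
  eo_act : eo_sgroup -> eo_space -> eo_space;
  eo_proj : eo_space -> X;
  eo_ext : is_extension alpha eo_act eo_proj }.

(* The group component of an arrow A' -> A goes backwards, from the group of A
   to the group of A'. *)
Record ext_hom (A' A : ext_obj) := ExtHom {
  eh_group : sgroup_hom (eo_sgroup A) (eo_sgroup A');
  eh_map : eo_space A' -> eo_space A;
  eh_cont : continuous eh_map;
  eh_proj : forall y, eo_proj (eh_map y) = eo_proj y;
  eh_equiv : forall g y,
    eh_map (eo_act (eh_group g) y) = eo_act g (eh_map y) }.

Lemma ext_hom_eq (A' A : ext_obj) (f g : ext_hom A' A) :
  eh_group f = eh_group g -> eh_map f = eh_map g -> f = g.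
Proof.
case: f g => [t p c q e] [t' p' c' q' e'] /= tt' pp'.
by subst t' p'; congr ExtHom; exact: Prop_irrelevance.
Qed.

Definition ext_id (A : ext_obj) : ext_hom A A.
Proof. by refine (@ExtHom A A (sgroup_id _) idfun _ _ _) => // y; exact. Defined.

Definition ext_comp (A B C : ext_obj) (f : ext_hom B C) (g : ext_hom A B) :
  ext_hom A C.
Proof.
refine (@ExtHom A C (sgroup_comp (eh_group g) (eh_group f))
                    (eh_map f \o eh_map g) _ _ _).
- by move=> y; apply: continuous_comp; exact: eh_cont.
- by move=> y; rewrite /= !eh_proj.
- by move=> h y; rewrite /= !eh_equiv.
Defined.

Definition Ext : category.
Proof.
by refine (@Category ext_obj ext_hom ext_id ext_comp _ _ _);
  move=> *; apply: ext_hom_eq => //; apply: sgroup_hom_eq.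
Defined.

End Ext.

Section NaturalExtension.
Variables (S : monoidType) (X : topologicalType) (alpha : S -> X -> X).
Variable G : sgroup S.

(* As a type, nat_space carries the subspace topology of the product
   topology. *)
Definition nat_space : set (prod_topology (fun _ : G => X)) :=
  [set x | forall s h, alpha s (x h) = x (sg_map G s * h)].

Lemma shift_subproof (g : G) (x : nat_space) :
  (fun h => \val x (h * g)) \in nat_space.
Proof.
by apply/mem_set => s h; rewrite (set_mem (valP x)) mulgA.
Qed.

Definition shift (g : G) (x : nat_space) : nat_space :=
  exist _ (fun h => \val x (h * g)) (shift_subproof g x).

(* Surjectivity of nat_proj is the only clause of
   [is_extension alpha shift nat_proj] that may fail, even if alpha is
   surjective and S embeddable; it holds as soon as alpha has a G-extension. *)
Definition nat_proj (x : nat_space) : X := \val x 1.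

End NaturalExtension.

Arguments nat_space {S X} alpha G.
Arguments shift {S X} alpha G.
Arguments nat_proj {S X} alpha G.

(* Main.v *)
(* If i embeds S in a group, the subgroup generated by i(S) is an S-group, and
   the S-group morphism from Gamma to it factors i through gamma, so gamma is
   injective.  Given a G-extension (Y, beta, tau), freeness yields a unique
   theta : Gamma -> G, and an equivariant phi : Y -> X_Gamma over X must satisfy
   phi(y)_h = pi(h . phi(y)) = pi(phi(theta(h) . y)) = tau(theta(h) . y);
   conversely this formula defines a morphism. *)
From HB Require Import structures.
Require Import Defs.
From mathcomp Require Import all_boot.
From mathcomp Require Import all_classical topology.

Local Open Scope classical_set_scope.

Section GeneratedSGroup.
Context {S : monoidType} {G : groupType} (i : {multiplicative S -> G}).

(** Quantifying over all subgroups containing the image of [i], in the style of [generates], avoids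
    words in generators and their inverses. *)
Definition generated : {pred G} := fun g =>
  `[< forall H : {pred G}, group_closed H -> (forall s, i s \in H) -> g \in H >].

Lemma generated_map s : i s \in generated.
Proof. by apply/asboolP => H _; apply. Qed.

Lemma generated_group_closed : group_closed generated.
Proof.
split=> [|x y /asboolP xG /asboolP yG]; apply/asboolP => H HG iH.
  by case: HG.
by apply: (proj2 HG); [exact: xG|exact: yG].
Qed.

Definition generated_type := {g : G | g \in generated}.
HB.instance Definition _ := SubChoice.on generated_type.
HB.instance Definition _ :=
  SubChoice_isSubGroup.Build G generated generated_type generated_group_closed.

Definition generated_in (s : S) : generated_type := Sub (i s) (generated_map s).

Lemma generated_in_morph : {morph generated_in : s t / (s * t)%g}.
Proof. by move=> s t; apply: val_inj; rewrite /= gmulfM. Qed.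

HB.instance Definition _ :=
  isMultiplicative.Build S generated_type generated_in generated_in_morph.

Lemma generated_in_generates : generates generated_in.
Proof.
move=> H [H1 Hdiv] iH g.
(* [K] is the image of [H] in [G]: a subgroup containing the image of [i], hence all of [generated].
   Injectivity of [val] then brings membership back to [H]. *)
pose K : {pred G} := fun x =>
  `[< exists2 h : generated_type, h \in H & val h = x >].
have /asboolP[h hH /val_inj <- //] : val g \in K.
have /asboolP gG : val g \in generated by exact: valP.
apply: gG => [|s]; last by apply/asboolP; exists (generated_in s).
split=> [|_ _ /asboolP[h hH <-] /asboolP[k kH <-]]; apply/asboolP.
  by exists 1%g.
by exists (h / k)%g; [exact: Hdiv|].
Qed.

Definition generated_sgroup : sgroup S := SGroup generated_in_generates.

End GeneratedSGroup.

Lemma free_sgroup_receiving (S : monoidType) (Gamma : sgroup S) :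
  embeddable S -> free_sgroup Gamma -> receiving Gamma.
Proof.
move=> [G [i i_inj]] /(_ (generated_sgroup i)) [f _] s t st.
apply: i_inj; have := congr1 (val \o f) st.
by rewrite /= !sgh_comm.
Qed.

(** The product topology is the supremum of the initial topologies of the coordinate maps, so
    convergence can be tested on each of them. *)
Lemma continuous_prod (I : Type) (T : I -> topologicalType)
    (Y : topologicalType) (f : Y -> prod_topology T) :
  (forall i, continuous (fun y => f y i)) -> continuous f.
Proof.
move=> fc y; apply/cvg_sup => i.
exact: (@continuous_comp_initial _ _ _
  (fun x : prod_topology T => x i) f (fc i) y).
Qed.

Section NatSpace.
Context {S : monoidType} {X : topologicalType} (alpha : S -> X -> X).
Context (G : sgroup S).

Lemma nat_space_eq (x y : nat_space alpha G) : \val x =1 \val y -> x = y.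
Proof. by move=> xy; apply: val_inj; apply: funext. Qed.

Lemma continuous_nat_space (Y : topologicalType) (f : Y -> nat_space alpha G) :
  (forall h, continuous (fun y => \val (f y) h)) -> continuous f.
Proof.
move=> fc; apply: (@continuous_comp_initial _ _ _ (@set_val _ (nat_space alpha G))).
exact: continuous_prod.
Qed.

Lemma nat_space_coord_continuous (h : G) :
  continuous (fun x : nat_space alpha G => \val x h).
Proof.
move=> x; apply: (@continuous_comp (nat_space alpha G)
  (prod_topology (fun _ : G => X)) X set_val (fun x => x h)).
  exact: (@initial_continuous _ _ (@set_val _ (nat_space alpha G))).
exact: (@proj_continuous G (fun=> X)).
Qed.

(** A point of [nat_space] is thus determined by the projections of its shift orbit, which is what
    forces the uniqueness of maps into it. *)
Lemma nat_proj_shift (g : G) (x : nat_space alpha G) :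
  nat_proj alpha G (shift alpha G g x) = \val x g.
Proof. by rewrite /nat_proj /= mul1g. Qed.

Lemma natural_extension :
  set_surj [set: nat_space alpha G] [set: X] (nat_proj alpha G) ->
  is_extension alpha (shift alpha G) (nat_proj alpha G).
Proof.
move=> proj_surj; split=> //.
- split=> [x|g h x|g].
  + by apply: nat_space_eq => h /=; rewrite mulg1.
  + by apply: nat_space_eq => k /=; rewrite mulgA.
  + by apply: continuous_nat_space => h; exact: nat_space_coord_continuous.
- exact: nat_space_coord_continuous.
(* This is the defining relation of [nat_space] at [h = 1]. *)
- move=> s x; rewrite nat_proj_shift.
  by rewrite /nat_proj (set_mem (valP x)) mulg1.
Qed.

End NatSpace.

(* [{multiplicative G -> H}] does not include [f 1 = 1], which needs
   cancellation in H. *)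
Lemma multiplicative1 (G H : groupType) (f : {multiplicative G -> H}) :
  (f 1 = 1)%g.
Proof. by apply: (mulgI (f 1%g)); rewrite -gmulfM !mulg1. Qed.

Section Classifying.
Context {S : monoidType} {X : topologicalType} {alpha : S -> X -> X}.
Context {G G' : sgroup S} (theta : sgroup_hom G G').
Context {Y : topologicalType} {beta : G' -> Y -> Y} {tau : Y -> X}.
Context (ext : is_extension alpha beta tau).

Lemma orbit_subproof (y : Y) :
  (fun h => tau (beta (theta h) y)) \in nat_space alpha G.
Proof.
case: ext => -[_ betaM _] _ _ tauE; apply/mem_set => s h.
(* With [eta] the map of [G'] and [gamma] that of [G], [eta s * theta h = theta (gamma s * h)]. *)
by rewrite tauE betaM -(sgh_comm theta) -gmulfM.
Qed.

Definition orbit_map (y : Y) : nat_space alpha G :=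
  exist _ (fun h => tau (beta (theta h) y)) (orbit_subproof y).

Lemma orbit_map_continuous : continuous orbit_map.
Proof.
case: ext => -[_ _ beta_cont] tau_cont _ _.
apply: continuous_nat_space => h y /=.
by apply: (@continuous_comp _ _ _ (beta (theta h)) tau);
  [exact: beta_cont|exact: tau_cont].
Qed.

Lemma nat_proj_orbit_map y : nat_proj alpha G (orbit_map y) = tau y.
Proof. by case: ext => -[beta1 _ _] _ _ _; rewrite /nat_proj /= multiplicative1 beta1. Qed.

(** Both sides have [h]-coordinate [tau (beta (theta (h * g)) y)]. *)
Lemma orbit_map_shift g y :
  orbit_map (beta (theta g) y) = shift alpha G g (orbit_map y).
Proof.
case: ext => -[_ betaM _] _ _ _; apply: nat_space_eq => h /=.
by rewrite betaM gmulfM.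
Qed.

Lemma orbit_map_unique (phi : Y -> nat_space alpha G) :
  (forall y, nat_proj alpha G (phi y) = tau y) ->
  (forall g y, phi (beta (theta g) y) = shift alpha G g (phi y)) ->
  phi = orbit_map.
Proof.
move=> phi_proj phi_equiv; apply: funext => y; apply: nat_space_eq => h /=.
by rewrite -phi_proj phi_equiv nat_proj_shift.
Qed.

End Classifying.

Theorem theorem3 (S : monoidType) (S_countable : countable [set: S])
    (S_embeddable : embeddable S)
    (X : topologicalType) (alpha : S -> X -> X)
    (alpha_action : continuous_action alpha)
    (alpha_surj : surjective_action alpha)
    (Gamma : sgroup S) (Gamma_free : free_sgroup Gamma)
    (proj_surj : set_surj [set: nat_space alpha Gamma] [set: X]
                   (nat_proj alpha Gamma)) :
  exists (Gamma_receiving : receiving Gamma)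
         (X_Gamma_ext :
            is_extension alpha (shift alpha Gamma) (nat_proj alpha Gamma)),
    @terminal (Ext alpha) (ExtObj Gamma_receiving X_Gamma_ext).
Proof.
exists (free_sgroup_receiving _ _ S_embeddable Gamma_free).
exists (natural_extension _ _ proj_surj) => -[G G_receiving Y beta tau ext].
(* The group component of an arrow into the candidate starts at [Gamma], so initiality of [Gamma]
   both supplies it and makes it unique. *)
have [theta theta_unique] := Gamma_free G.
unshelve eexists.
  by exists theta (orbit_map theta ext);
    [exact: orbit_map_continuous|exact: nat_proj_orbit_map|exact: orbit_map_shift].
move=> [theta' phi phi_cont phi_proj phi_equiv].
have theta'E : theta' = theta := theta_unique theta'.
(* Once the group components agree, [phi] is equivariant along [theta] itself. *)
subst theta'; apply: ext_hom_eq => //=.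
exact: orbit_map_unique.
Qed.
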